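(* The numbers $e(D_r(\mathcal{PB}_n))$ satisfy the recurrence $$e(D_n(\mathcal{PB}_n))=1,\qquad e(D_0(\mathcal{PB}_n))=a_n^2,$$ and, for $n\ge1$ and $1\le r\le n-1$, \begin{align*} e(D_r(\mathcal{PB}_n))&=\sum_{i=1}^{\lfloor\frac n2\rfloor}\binom{n-1}{2i-1}(2i+1)\cdot(2i-1)!\;e(D_r(\mathcal{PB}_{n-2i}))\\ &\quad+\sum_{i=0}^{\lfloor\frac{n-1}2\rfloor}\binom{n-1}{2i}(2i+1)!\,\Big(e(D_r(\mathcal{PB}_{n-2i-1}))+e(D_{r-1}(\mathcal{PB}_{n-2i-1}))\Big), \end{align*} where the numbers $a_n$ are defined by $a_0=a_1=1$ and $a_n=a_{n-1}+(n-1)a_{n-2}$ for $n\ge2$.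
   Context: Write $\mathbf n=\{1,\dots,n\}$ and let $\mathbf n'$ be a disjoint copy. The partial Brauer monoid $\mathcal{PB}_n$ is the set of all set partitions $\alpha$ of $\mathbf n\cup\mathbf n'$ into non-empty blocks of size at most $2$ ($\mathcal{PB}_0=\{\emptyset\}$). Product: for $\alpha,\beta\in\mathcal{PB}_n$ take a third copy $\mathbf n''$; relabel each lower vertex $x'$ of $\alpha$ as $x''$ and each upper vertex $x$ of $\beta$ as $x''$, and take the union graph $\Gamma(\alpha,\beta)$ on $\mathbf n\cup\mathbf n'\cup\mathbf n''$ (blocks of size $2$ being viewed as edges); $x,y\in\mathbf n\cup\mathbf n'$ are in the same block of $\alpha\beta$ iff they are joined by a path in $\Gamma(\alpha,\beta)$. The rank of $\alpha$ is the number of blocks meeting both $\mathbf n$ and $\mathbf n'$, and $D_r(\mathcal{PB}_n)=\{\alpha\in\mathcal{PB}_n:\operatorname{rank}(\alpha)=r\}$ (empty if $r>n$). For $\Sigma\subseteq\mathcal{PB}_n$, $e(\Sigma)$ is the number of $\alpha\in\Sigma$ with $\alpha^2=\alpha$. *)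

(* Defs.v *)
From mathcomp Require Import all_boot.

Set Implicit Arguments.
Unset Strict Implicit.
Unset Printing Implicit Defensive.

(* An upper vertex x is inl x, a lower vertex x' is inr x; indices are
   shifted to {0, .., n-1}. *)
Definition vertex (n : nat) : finType := ('I_n + 'I_n)%type.

Definition PB (n : nat) : {set {set {set vertex n}}} :=
  [set alpha : {set {set vertex n}} |
    partition alpha [set: vertex n] && [forall B in alpha, #|B| <= 2]].

(* inl v for a vertex v of the first two copies; inr x for x'' in the third. *)
Definition vertex3 (n : nat) : finType := (vertex n + 'I_n)%type.

Definition relabel_lower (n : nat) (v : vertex n) : vertex3 n :=
  match v with
  | inl x => inl (inl x)
  | inr x => inr x
  end.

Definition relabel_upper (n : nat) (v : vertex n) : vertex3 n :=
  match v with
  | inl x => inr x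
  | inr x => inl (inr x)
  end.

Definition block_edge (n : nat) (f : vertex n -> vertex3 n)
    (alpha : {set {set vertex n}}) : rel (vertex3 n) :=
  [rel u v | [exists B in alpha, (#|B| == 2) && (f @: B == [set u; v])]].

Definition product_graph (n : nat) (alpha beta : {set {set vertex n}}) :
    rel (vertex3 n) :=
  [rel u v | block_edge (@relabel_lower n) alpha u v
          || block_edge (@relabel_upper n) beta u v].

Definition pb_mul (n : nat) (alpha beta : {set {set vertex n}}) :
    {set {set vertex n}} :=
  equivalence_partition
    (fun x y : vertex n => connect (product_graph alpha beta) (inl x) (inl y))
    [set: vertex n].

Definition pb_rank (n : nat) (alpha : {set {set vertex n}}) : nat :=
  #|[set B in alpha | [exists x : 'I_n, inl x \in B]
                   && [exists y : 'I_n, inr y \in B]]|.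

Definition D (r n : nat) : {set {set {set vertex n}}} :=
  [set alpha in PB n | pb_rank alpha == r].

Definition e (n : nat) (Sigma : {set {set {set vertex n}}}) : nat :=
  #|[set alpha in Sigma | pb_mul alpha alpha == alpha]|.

Fixpoint a (n : nat) : nat :=
  match n with
  | 0 => 1
  | k.+1 => match k with
            | 0 => 1
            | j.+1 => a k + k * a j
            end
  end.

(* Main.v *)
Require Import Defs.
From mathcomp Require Import all_boot.
From mathcomp Require Import zify ring.

(** A partition into blocks of size at most [2] is the same as the involution
    [s] that sends each vertex to its partner (itself for a singleton), so the
    diagrams are the involutions of the [2 * n] vertices, here called ports.

    Take the graph on the [n] indices whose edges are the upper and the lower
    hooks of the diagram, that is, the blocks of size [2] inside one row.  It
    is what lies in the middle row when the diagram is multiplied by itself.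
    Each index has one upper and one lower port, so the components are
    alternating paths and cycles, and a path has exactly two unhooked ports,
    one at each end ([two_unhooked]).  A block crossing from [x] to the lower
    [y] survives in the square precisely if the middle row leads from [y] back
    to [x]; hence the diagram is idempotent iff the indices of every crossing
    block lie in one component of hooks, where they are the two ends
    ([linked_idempotent], [idempotent_linked]).  The ends of a path
    lie on different sides exactly when the path has an odd number of
    indices, and then one has the choice whether a crossing block joins them.

    The recurrence sorts the idempotents by the component of the index [0].
    Exploring this component means to prolong a path at its two ends; with [l]
    further indices there are [n.-1 ^_ l] ordered choices of these indices and
    [l.+1] ways to distribute them between the two ends.  If [l] is odd, the
    two ends lie on the same side and may also be joined by a hook.  That gives
    one more possibility for each ordered choice, not [l.+1] more: a cycle
    closes while the first end is being prolonged, so all the new indices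
    belong to that end.  If [l] is even, the two ends may be joined by a
    crossing block, which accounts for one unit of the rank.  The rest is an arbitrary diagram of the same
    kind on the remaining indices ([card_linked_prescribed]), whence
    [card_linked_rec].  Substituting [l = 2 * i - 1] and [l = 2 * i] gives the
    two sums of the theorem. *)

Set Implicit Arguments.
Unset Strict Implicit.
Unset Printing Implicit Defensive.

(** * Involutions with prescribed values *)

Definition involutions (P : finType) : {set {ffun P -> P}} :=
  [set s : {ffun P -> P} | [forall z, s (s z) == z]].

Lemma involutionsP (P : finType) (s : {ffun P -> P}) :
  reflect (involutive s) (s \in involutions P).
Proof. by rewrite inE; apply: (iffP forallP) => h z; apply/eqP. Qed.

Section Glue.

Variables (P1 P2 : finType) (F : P1 -> P2) (s0 : {ffun P2 -> P2}).
Hypothesis injF : injective F.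

(** The involution of the large set that copies [s1] on the image of [F] and
    follows the prescribed [s0] elsewhere. *)
Definition glue (s1 : {ffun P1 -> P1}) : {ffun P2 -> P2} :=
  [ffun z => if [pick p | F p == z] is Some p then F (s1 p) else s0 z].

Lemma glue_in s1 p : glue s1 (F p) = F (s1 p).
Proof.
rewrite ffunE; case: pickP => [q /eqP/injF -> //|/(_ p)].
by rewrite eqxx.
Qed.

Lemma glue_out s1 z : z \notin codom F -> glue s1 z = s0 z.
Proof.
move=> zF; rewrite ffunE; case: pickP => // p /eqP Fp.
by rewrite -Fp codom_f in zF.
Qed.

Lemma glue_inj : injective glue.
Proof.
move=> s t st; apply/ffunP=> p; apply: injF.
by rewrite -!glue_in st.
Qed.

Hypothesis s0K : involutive s0.
Hypothesis s0F : forall z, z \notin codom F -> s0 z \notin codom F.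

(** Prescribing an involution on a stable set leaves exactly the choice of an
    involution of the complement: this is how a finished component is
    deleted. *)
Lemma imset_glue :
  [set s in involutions P2 | [forall (z | z \notin codom F), s z == s0 z]]
    = glue @: involutions P1.
Proof.
apply/setP=> s; rewrite inE; apply/andP/imsetP => [[/involutionsP sK] | ].
  move=> /forall_inP sE.
  have sF p : s (F p) \in codom F.
    apply: contraT => nF; have := s0F nF.
    by rewrite -(eqP (sE _ nF)) sK codom_f.
  pose s1 := [ffun p => iinv (sF p)].
  have Fs1 p : F (s1 p) = s (F p) by rewrite ffunE f_iinv.
  exists s1; first by apply/involutionsP=> p; apply: injF; rewrite !Fs1 sK.
  apply/ffunP=> z; have [/codomP [p ->]|zF] := boolP (z \in codom F).
    by rewrite glue_in Fs1.
  by rewrite glue_out //; apply/eqP/sE.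
case=> s1 /involutionsP s1K ->; split; last first.
  by apply/forall_inP=> z zF; rewrite glue_out.
apply/involutionsP=> z; have [/codomP [p ->]|zF] := boolP (z \in codom F).
  by rewrite !glue_in s1K.
by rewrite !glue_out ?s0K ?s0F.
Qed.

End Glue.

Definition swap_at (P : finType) (s : {ffun P -> P}) (p q : P) :
    {ffun P -> P} :=
  [ffun z => if z == p then q else if z == q then p else s z].

Section SwapAt.
Variables (P : finType) (s : {ffun P -> P}) (p q : P).
Hypotheses (sK : involutive s) (sp : s p = p) (sq : s q = q).

Lemma swap_atL : swap_at s p q p = q.
Proof. by rewrite ffunE eqxx. Qed.

Lemma swap_atR : swap_at s p q q = p.
Proof. by rewrite ffunE eqxx; case: eqP. Qed.

Lemma swap_atN z : z != p -> z != q -> swap_at s p q z = s z.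
Proof. by rewrite ffunE => /negPf -> /negPf ->. Qed.

Lemma swap_at_involutive : involutive (swap_at s p q).
Proof.
move=> z; have [->|zp] := eqVneq z p; first by rewrite swap_atL swap_atR.
have [->|zq] := eqVneq z q; first by rewrite swap_atR swap_atL.
rewrite !swap_atN //.
  by apply: contra zp => /eqP szp; rewrite -(sK z) szp sp.
by apply: contra zq => /eqP szq; rewrite -(sK z) szq sq.
Qed.

End SwapAt.

Lemma card_fibres (S T : finType) (A : {set S}) (B : {set T}) (f : S -> T) :
  {in A, forall x, f x \in B} ->
  #|A| = \sum_(y in B) #|[set x in A | f x == y]|.
Proof.
move=> AB; rewrite -sum1_card (partition_big f (mem B)) //=.
by apply: eq_bigr => y _; rewrite -sum1_card; apply: eq_bigl => x; rewrite inE.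
Qed.

(** Fixing the partner of [v] removes [v] and that partner from the set; taking
    [w = v] covers the case where [v] is a fixed point. *)
Lemma card_involutions_at (T : finType) (v w : T) :
  #|[set s in involutions T | s v == w]|
    = #|involutions {x : T | (x != v) && (x != w)}|.
Proof.
pose sT : finType := {x : T | (x != v) && (x != w)}.
pose s0 := swap_at [ffun z : T => z] v w.
have s0K : involutive s0.
  by apply: swap_at_involutive => [z||]; rewrite !ffunE.
have codomE z : (z \notin codom (val : sT -> T)) = (z == v) || (z == w).
  apply/idP/idP => [|zvw].
    apply: contraR => zvw; rewrite negb_or in zvw.
    by apply/codomP; exists (Sub z zvw).
  apply/codomP=> -[[u /= /andP [uv uw]] E]; move: zvw.
  by rewrite E (negPf uv) (negPf uw).
rewrite -(card_imset _ (@glue_inj _ _ (val : sT -> T) s0 val_inj)).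
rewrite -imset_glue //; last 2 first.
- exact: val_inj.
- by move=> z; rewrite !codomE => /orP [] /eqP ->;
    rewrite ?swap_atL ?swap_atR eqxx ?orbT.
congr #|pred_of_set _|; apply/setP=> s; rewrite !inE.
apply: andb_id2l => /forallP sK.
apply/eqP/forall_inP => [sv z | sE].
  rewrite codomE => /orP [] /eqP ->; rewrite ?swap_atL ?swap_atR // ?sv //.
  by rewrite -sv (eqP (sK v)).
by rewrite (eqP (sE v _)) ?swap_atL // codomE eqxx.
Qed.

(** The recurrence for [a] sorts the involutions by the partner of one point:
    itself, or one of the others. *)
Lemma card_involutions (T : finType) : #|involutions T| = a #|T|.
Proof.
move: {2}#|T| (erefl #|T|) => n; elim/ltn_ind: n T => n IHn T Tn.
have [T0|] := posnP n.
  rewrite Tn T0 /=; apply/eqP/cards1P.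
  have noT (x : T) : False by have := fintype0 x; rewrite Tn T0 => /(_ erefl).
  exists [ffun x => x]; apply/setP=> s; rewrite inE.
  have -> : s = [ffun x => x] by apply/ffunP=> x; case: (noT x).
  by rewrite inE eqxx; apply/forallP=> x; case: (noT x).
rewrite -Tn => /card_gt0P [v _].
have sub w : #|{: {x : T | (x != v) && (x != w)}}| = #|T| - #|[set v; w]|.
  rewrite card_sig -(cardsC [set v; w]) addKn -cardsE; apply: eq_card => x.
  by rewrite !inE negb_or.
have sub1 : #|{: {x : T | (x != v) && (x != v)}}| = n.-1.
  by rewrite sub setUid cards1 Tn subn1.
have sub2 w : w != v -> #|{: {x : T | (x != v) && (x != w)}}| = n.-2.
  by move=> wv; rewrite sub cards2 eq_sym wv Tn subn2.
have n0 : 0 < n by rewrite -Tn; apply/card_gt0P; exists v.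
rewrite (@card_fibres _ _ _ [set: T]
  (fun s : {ffun T -> T} => s v)); last first.
  by move=> s _; rewrite inE.
rewrite (bigD1 v) ?inE //= card_involutions_at (IHn n.-1) ?sub1 //; last by lia.
rewrite (eq_bigr (fun=> a n.-2)) => [|w /andP [_ wv]]; last first.
  by rewrite card_involutions_at (IHn n.-2) ?sub2 //; lia.
rewrite sum_nat_const.
have -> : #|[pred w in [set: T] | w != v]| = n.-1.
  rewrite -Tn -(cardC1 v); apply: eq_card => w; by rewrite !inE.
rewrite ?Tn.
by case: n {IHn Tn sub1 sub2} n0 => // -[|n] _ //=; rewrite mul0n addn0.
Qed.

(** * Ports, hooks and crossings *)

Section TwoInvolutions.

Variables (P : finType) (t i : P -> P).
Hypotheses (tK : involutive t) (iK : involutive i).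
Let rho := t \o i.

Let rho_inj : injective rho.
Proof. exact: inj_comp (inv_inj tK) (inv_inj iK). Qed.

(* [t] inverts [rho] by conjugation. *)
Let iter_tr k x : iter k rho (t (iter k rho x)) = t x.
Proof.
elim: k x => [//|k IHk] x; rewrite iterSr iterS /= -/rho.
by rewrite /rho /= tK iK IHk.
Qed.

(** The orbit of a point under the dihedral group generated by [t] and [i] is
    already its orbit under [rho] when the point is fixed by [t], because
    [t] sends the [k]-th iterate to the [-k]-th. *)
Lemma orbit_fixed_point_closed x y : t x = x -> fconnect rho x y ->
  fconnect rho x (t y) /\ fconnect rho x (i y).
Proof.
move=> tx.
have closed_t z : fconnect rho x z -> fconnect rho x (t z).
  move=> /iter_findex <-; set k := findex _ _ _.
  have := fconnect_iter rho k (t (iter k rho x)).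
  by rewrite iter_tr tx fconnect_sym.
move=> xy; split; first exact: closed_t.
rewrite -(tK (i y)) -/(rho y); apply: closed_t.
exact: connect_trans xy (fconnect1 _ _).
Qed.

(** A dihedral orbit contains at most two fixed points of [t]: if [x] is one
    of them and the cycle of [rho] through [x] has length [m], then the [k]-th
    iterate of [x] is fixed only if [m] divides [2 * k].  For [k < m] and
    [k != 0] this leaves [2 * k = m]. *)
Lemma two_fixed_points x y z : t x = x -> t y = y -> t z = z ->
  fconnect rho x y -> fconnect rho x z -> y != x -> z != x -> y = z.
Proof.
move=> tx ty tz.
have half u : t u = u -> fconnect rho x u -> u != x ->
    findex rho x u + findex rho x u = fingraph.order rho x.
  move=> tu xu ux; have := iter_findex xu; have := findex_max xu.
  set k := findex _ _ _; set m := fingraph.order _ _ => km ku.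
  have kx : iter (k + k) rho x = x by rewrite iterD ku -tu -ku iter_tr.
  have k0 : k != 0 by apply: contra ux => /eqP k0; rewrite -ku k0.
  case: (ltnP (k + k) m) => [lt|le].
    have := findex_iter lt; rewrite kx findex0; lia.
  have lt : k + k - m < m by lia.
  have := findex_iter lt.
  have -> : iter (k + k - m) rho x = x.
    by rewrite -[in LHS](iter_order rho_inj x) -iterD subnK.
  by rewrite findex0; lia.
move=> xy xz yx zx.
have := half y ty xy yx; rewrite -(half z tz xz zx) => E.
by rewrite -(iter_findex xy) -(iter_findex xz); congr (iter _ _ _); lia.
Qed.

End TwoInvolutions.

Lemma connect_ind (T : finType) (e : rel T) (S : T -> Prop) x y :
  (forall u v, S u -> e u v -> S v) -> S x -> connect e x y -> S y.
Proof.
move=> step Sx /connectP [c]; elim: c x Sx => [|u c IHc] x Sx /= => [_ ->//|].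
by case/andP=> xu uc; apply: IHc uc; apply: step xu.
Qed.

Section Ports.

Variable n : nat.
Implicit Types (z p q : vertex n) (x y : 'I_n) (b : bool)
  (s : {ffun vertex n -> vertex n}).

Definition side z := if z is inl _ then true else false.
Definition und z := match z with inl x => x | inr x => x end.
Definition port b x : vertex n := if b then inl x else inr x.

(** The other copy of the same index: the two vertices that are glued together
    in the middle row of the product of a diagram with itself. *)
Definition flip z := port (~~ side z) (und z).

Lemma portK z : port (side z) (und z) = z. Proof. by case: z. Qed.
Lemma side_port b x : side (port b x) = b. Proof. by case: b. Qed.
Lemma und_port b x : und (port b x) = x. Proof. by case: b. Qed.
Lemma flipK : involutive flip. Proof. by case. Qed.

Lemma und_eq z p : und z = und p -> z = p \/ z = flip p.
Proof. by case: z p => x [] y /= ->; [left|right|right|left]. Qed.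

(** The graph seen in the middle row of the product of a diagram with itself:
    an edge for every upper and for every lower hook.  A singleton block only
    contributes a harmless loop. *)
Definition hook_rel s : rel 'I_n :=
  [rel x y | [exists b, s (port b x) == port b y]].

Lemma hook_relP s x y :
  reflect (exists b, s (port b x) = port b y) (hook_rel s x y).
Proof. by apply: (iffP existsP) => -[b /eqP]; exists b => //; apply/eqP. Qed.

(** Since a crossing block ends the hooks at both of its indices, this says that
    its indices are the two ends of one path of hooks. *)
Definition linked s := [forall x, forall y,
  (s (inl x) == inr y) ==> connect (hook_rel s) x y].

Definition rank s := #|[set x | ~~ side (s (inl x))]|.

Definition linked_inv r : {set {ffun vertex n -> vertex n}} :=
  [set s in involutions (vertex n) | linked s && (rank s == r)].

(** The hook graph has no edge at such a port, apart from a possible loop. *)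
Definition unhooked s p := (s p == p) || (side (s p) != side p).

Lemma unhooked_partner s p : involutive s -> unhooked s p -> unhooked s (s p).
Proof. by move=> sK; rewrite /unhooked sK (eq_sym p) (eq_sym (side p)). Qed.

Lemma hook_rel_sym s : involutive s -> symmetric (hook_rel s).
Proof.
move=> sK x y.
by apply/hook_relP/hook_relP => -[b E]; exists b; rewrite -E sK.
Qed.

Lemma linkedP s : involutive s ->
  reflect (forall p, side (s p) != side p ->
             connect (hook_rel s) (und p) (und (s p))) (linked s).
Proof.
move=> sK; have symc := sym_connect_sym (hook_rel_sym sK).
apply: (iffP forallP) => [gs p|gs x].
  case: p => x; case E: (s _) => [y|y] //= _.
    by apply: (implyP (forallP (gs x) y)); rewrite E.
  by rewrite symc; apply: (implyP (forallP (gs y) x)); rewrite -E sK.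
apply/forallP=> y; apply/implyP=> /eqP E.
by have := gs (inl x); rewrite E; apply.
Qed.

(** Every index meets at most one upper and one lower hook, so a component of
    the hook graph is a path or a cycle, and a path has two free ports, one at
    each end (both at the same index when the path is a point).  In the proof
    hooks and [flip] are two involutions of the ports, the former fixing
    exactly the unhooked ones. *)
Lemma two_unhooked s p q z : involutive s ->
  unhooked s p -> unhooked s q -> unhooked s z ->
  connect (hook_rel s) (und p) (und q) ->
  connect (hook_rel s) (und p) (und z) ->
  q != p -> z != p -> q = z.
Proof.
move=> sK.
pose t u := if side (s u) == side u then s u else u.
have tK : involutive t.
  move=> u; rewrite /t; case: (eqVneq (side (s u))) => [E|/negPf-> //].
  by rewrite sK E eqxx.
have t_fix u : unhooked s u -> t u = u.
  by rewrite /t /unhooked; case: (_ == side u) => //=; rewrite orbF => /eqP.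
move=> /t_fix tp /t_fix tq /t_fix tz.
have orb u : connect (hook_rel s) (und p) (und u) -> fconnect (t \o flip) p u.
  move=> pu; pose S x := forall u, und u = x -> fconnect (t \o flip) p u.
  have closed v := orbit_fixed_point_closed (y := v) tK flipK tp.
  have S1 v : fconnect (t \o flip) p v -> S (und v).
    by move=> pv w /und_eq [->//|->]; case: (closed _ pv).
  suff: S (und u) by apply.
  apply: (connect_ind (S := S) _ _ pu); last by apply: S1; apply: connect0.
  move=> x y Sx /hook_relP [b E].
  rewrite -(und_port b y); apply: S1.
  have -> : port b y = t (port b x) by rewrite /t E !side_port eqxx.
  by apply: (closed _ _).1; apply: Sx; rewrite und_port.
move=> /orb pq /orb pz; exact: two_fixed_points tK flipK _ _ _ tp tq tz pq pz.
Qed.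

Lemma connect_hook_mono s0 s :
  (forall z, s0 z != z -> s z = s0 z) ->
  subrel (connect (hook_rel s0)) (connect (hook_rel s)).
Proof.
move=> ss; apply: connect_sub => x y /hook_relP [b E].
have [xy|xy] := eqVneq (port b y) (port b x).
  have -> : y = x by rewrite -(und_port b y) xy und_port.
  exact: connect0.
by apply: connect1; apply/hook_relP; exists b; rewrite ss ?E.
Qed.

End Ports.

(** * Diagrams as involutions, and idempotency *)

Section Blocks.

Variable T : finType.
Implicit Types (s : {ffun T -> T}) (al : {set {set T}}).

Definition blocks s : {set {set T}} := [set [set z; s z] | z : T].

Lemma block_eq s z w : involutive s -> w \in [set z; s z] ->
  [set w; s w] = [set z; s z].
Proof. by move=> sK /set2P [->//|->]; rewrite sK setUC. Qed.

Lemma blocks_partition s : involutive s -> partition (blocks s) [set: T].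
Proof.
move=> sK; apply/and3P; split.
- apply/eqP/setP=> z; rewrite inE; apply/bigcupP; exists [set z; s z].
    exact: imset_f.
  by rewrite !inE eqxx.
- apply/trivIsetP=> _ _ /imsetP [z _ ->] /imsetP [w _ ->].
  apply: contraR; rewrite -setI_eq0 => /set0Pn [u /setIP [uz uw]].
  by apply/eqP; rewrite -(block_eq sK uz) -(block_eq sK uw).
- by apply/imsetP=> -[z _ E]; have := set21 z (s z); rewrite -E inE.
Qed.

Lemma blocks_inj : {in involutions T &, injective blocks}.
Proof.
move=> s t /involutionsP sK /involutionsP tK st; apply/ffunP=> z.
have : [set z; s z] \in blocks t by rewrite -st; apply: imset_f.
case/imsetP=> w _ E.
have zw : z \in [set w; t w] by rewrite -E !inE eqxx.
rewrite -(block_eq tK zw) in E.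
have : s z \in [set z; t z] by rewrite -E !inE eqxx orbT.
case/set2P=> // sz; have : t z \in [set z; s z] by rewrite E !inE eqxx orbT.
by rewrite sz setUid => /set1P.
Qed.

(** In a partition into blocks of size at most [2] every point has a well
    defined partner, itself when it is alone. *)
Lemma blocks_surj al : partition al [set: T] -> [forall B in al, #|B| <= 2] ->
  exists2 s, s \in involutions T & blocks s = al.
Proof.
move=> pal /forall_inP le2; have [/eqP cov triv al0] := and3P pal.
have zB z : z \in pblock al z by rewrite mem_pblock cov.
have Bal z : pblock al z \in al by rewrite pblock_mem // cov.
have mate z : exists w, pblock al z == [set z; w].
  have [w|noB] := pickP [pred w in pblock al z | w != z].
    case/andP=> wB wz; exists w.
    by rewrite eq_sym eqEcard subUset !sub1set zB wB cards2 eq_sym wz le2.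
  exists z; rewrite setUid eqEsubset sub1set zB andbT.
  by apply/subsetP=> w wB; have := noB w; rewrite !inE wB => /negbFE.
pose s := [ffun z => xchoose (mate z)].
have sE z : pblock al z = [set z; s z].
  by rewrite ffunE; apply/eqP/(xchooseP (mate z)).
exists s.
  apply/involutionsP=> z.
  have sB : s z \in pblock al z by rewrite sE !inE eqxx orbT.
  have E : [set s z; s (s z)] = [set z; s z].
    by rewrite -!sE (same_pblock triv sB).
  have [sz|sz] := eqVneq (s z) z; first by rewrite !sz.
  have : z \in [set s z; s (s z)] by rewrite E !inE eqxx.
  by case/set2P => // zs; rewrite -zs eqxx in sz.
apply/setP=> B; apply/imsetP/idP => [[z _ ->]|Bal'].
  by rewrite -sE.
have /set0Pn [z zB'] : B != set0 by apply: contraNneq al0 => <-.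
by exists z => //; rewrite -sE (def_pblock triv Bal' zB').
Qed.

End Blocks.

Lemma relabel_lower_inj n : injective (@relabel_lower n).
Proof. by move=> [x|x] [y|y] // [->]. Qed.

Lemma relabel_upper_inj n : injective (@relabel_upper n).
Proof. by move=> [x|x] [y|y] // [->]. Qed.

Section Idempotents.

Variables (n : nat) (s : {ffun vertex n -> vertex n}).
Hypothesis sK : involutive s.

Lemma block_edgeP (f : vertex n -> vertex3 n) u v : injective f ->
  reflect (exists z, [/\ s z != z, u = f z & v = f (s z)])
          (block_edge f (blocks s) u v).
Proof.
move=> injf; apply: (iffP exists_inP) => [[_ /imsetP [z _ ->]]|[z [zs -> ->]]].
  rewrite cards2 => /andP [zs /eqP E].
  have {}zs : s z != z by move: zs; rewrite (eq_sym z); case: (_ == z).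
  have fz : f z \in [set u; v] by rewrite -E imset_f // set21.
  have fsz : f (s z) \in [set u; v] by rewrite -E imset_f // set22.
  have neq : f (s z) != f z by rewrite (inj_eq injf).
  case/set2P: fz fsz neq => fz /set2P [] fsz; rewrite ?fz ?fsz ?eqxx // => _.
    by exists z; rewrite fz fsz.
  by exists (s z); rewrite sK fz fsz eq_sym.
exists [set z; s z]; first exact: imset_f.
by rewrite cards2 (eq_sym z) zs imsetU1 imset_set1 eqxx.
Qed.

Let e := product_graph (blocks s) (blocks s).

Let edgeP u v : reflect
  (exists z, s z != z /\ ((u = relabel_lower z /\ v = relabel_lower (s z)) \/
                          (u = relabel_upper z /\ v = relabel_upper (s z))))
  (e u v).
Proof.
apply: (iffP orP) => [[]|[z [zs [[uz vz]|[uz vz]]]]].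
- case/(block_edgeP _ _ (@relabel_lower_inj n)) => z [zs uz vz].
  by exists z; split; [|left].
- case/(block_edgeP _ _ (@relabel_upper_inj n)) => z [zs uz vz].
  by exists z; split; [|right].
- by left; apply/(block_edgeP _ _ (@relabel_lower_inj n)); exists z.
- by right; apply/(block_edgeP _ _ (@relabel_upper_inj n)); exists z.
Qed.

Let e_sym : symmetric e.
Proof.
move=> u v; apply/edgeP/edgeP => -[z [zs H]]; exists (s z);
  by rewrite sK eq_sym; split => //; case: H => -[-> ->]; [left|right].
Qed.

(** The blocks of the square are the connected components of the outer
    vertices, so idempotency compares these components with the blocks. *)
Lemma pb_mul_idemP :
  reflect (forall z w, connect e (inl z) (inl w) = (w \in [set z; s z]))
          (pb_mul (blocks s) (blocks s) == blocks s).
Proof.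
have mulE : pb_mul (blocks s) (blocks s) =
    [set [set w | connect e (inl z) (inl w)] | z : vertex n].
  rewrite /pb_mul /equivalence_partition; apply/setP=> B.
  by apply/imsetP/imsetP => -[z _ ->]; exists z; rewrite ?inE //;
    apply/setP=> w; rewrite !inE.
rewrite mulE; apply: (iffP eqP) => [E z w|E].
  have : [set w | connect e (inl z) (inl w)] \in blocks s.
    by rewrite -E; apply: imset_f.
  case/imsetP=> u _ Eu.
  have zu : z \in [set u; s u] by rewrite -Eu inE connect0.
  by rewrite (block_eq sK zu) -Eu inE.
by apply: eq_imset => z; apply/setP=> w; rewrite inE E.
Qed.

Let middle x y : connect (hook_rel s) x y -> connect e (inr x) (inr y).
Proof.
move=> xy; pose S u := connect e (inr x) (inr u).
suff: S y by [].
apply: (connect_ind (S := S) _ _ xy); last exact: connect0.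
move=> u v xu /hook_relP [b E].
have [uv|uv] := eqVneq u v; first by rewrite -uv.
apply: connect_trans xu (connect1 _); apply/edgeP; exists (port b u).
rewrite E; split.
  by apply: contra uv => /eqP /(congr1 (@und n)); rewrite !und_port => ->.
by case: b {E}; [right|left].
Qed.

(** Through the middle row, a crossing block is continued by the path of hooks
    between its two indices and then by its own second copy.  Nothing else is
    reached: a further crossing leaving the same component would give it a
    third unhooked port. *)
Lemma linked_idempotent : linked s -> pb_mul (blocks s) (blocks s) == blocks s.
Proof.
move=> gs; have symH := sym_connect_sym (hook_rel_sym sK).
apply/pb_mul_idemP => z w; apply/idP/set2P => [zw|]; last first.
  case=> ->; first exact: connect0.
  have [sz|sz] := eqVneq (s z) z; first by rewrite sz connect0.
  have cross x y : s (inl x) = inr y -> connect e (inl (inl x)) (inl (inr y)).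
    move=> xy; apply: (@connect_trans _ _ (inr y)).
      apply: connect1; apply/edgeP; exists (inl x).
      by rewrite xy; split=> //; left.
    apply: (@connect_trans _ _ (inr x)).
      apply: middle; rewrite symH.
      by apply: (implyP (forallP (forallP gs x) y)); rewrite xy.
    apply: connect1; apply/edgeP; exists (inl x).
    by rewrite xy; split=> //; right.
  case: z sz => x; case E: (s _) => [y|y] sz.
  - apply: connect1; apply/edgeP; exists (inl x).
    by rewrite E; split=> //; left.
  - exact: cross.
  - by rewrite (sym_connect_sym e_sym); apply: cross; rewrite -E sK.
  - apply: connect1; apply/edgeP; exists (inr x).
    by rewrite E; split=> //; right.
(* The component of [z] in the product graph is contained in [S]. *)
pose S (u : vertex3 n) := match u with
  | inl v => v = z \/ v = s z
  | inr x => side (s z) != side z /\ connect (hook_rel s) (und z) x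
  end.
suff: S (inl w) by [].
apply: (connect_ind (S := S) _ _ zw); last by left.
move=> u v Su /edgeP [p [ps uv]].
have hookS b x y : s (port b x) = port b y -> S (inr x) -> S (inr y).
  move=> E [cz zx]; split=> //; apply: connect_trans zx (connect1 _).
  by apply/hook_relP; exists b.
have Sz q : q = z \/ q = s z -> s q = z \/ s q = s z.
  by case=> ->; [right|left; rewrite sK].
have inS q : q = z \/ q = s z -> side (s q) != side q -> S (inr (und (s q))).
  move=> qz cq.
  have cz : side (s z) != side z by case: qz cq => -> //; rewrite sK eq_sym.
  split=> //; case: qz => -> //; last by rewrite sK connect0.
  exact: (linkedP sK gs).
have outS q x : S (inr x) -> side (s q) != side q -> und (s q) = x ->
    q = z \/ q = s z.
  move=> [cz zx] cq sqx.
  have cc r : side (s r) != side r -> unhooked s r.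
    by rewrite /unhooked => ->; rewrite orbT.
  have uq : connect (hook_rel s) (und z) (und q).
    apply: connect_trans zx _; rewrite -sqx symH.
    exact: (linkedP sK gs).
  have us := linkedP sK gs _ cz.
  have [->|qz] := eqVneq q z; first by left.
  right; apply: (two_unhooked sK (cc _ cz) (cc _ cq) _ uq us qz).
    by apply: unhooked_partner => //; apply: cc.
  by apply: contra cz => /eqP ->.
(* [b] tells from which of the two copies of the diagram the edge comes. *)
have [b [Eu Ev]] : exists b,
    u = (if side p == b then inl p else inr (und p)) /\
    v = (if side (s p) == b then inl (s p) else inr (und (s p))).
  by case: uv => -[-> ->]; [exists true|exists false]; case: (p) (s p) => x [].
move: Su; rewrite {}Eu {}Ev; case: eqVneq => [pb|pb]; case: eqVneq => [spb|spb].
- exact: Sz.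
- by move=> Sp; apply: inS => //; rewrite pb.
- by move=> Sp; apply: outS Sp _ _; rewrite sK // spb.
- apply: (hookS (side p)); rewrite portK.
  have <- : side (s p) = side p.
    by move: spb pb; case: (side _); case: (side p); case: (b).
  by rewrite portK.
Qed.

(** If [x] and [y] were not joined by hooks, the walk that enters the middle row
    through the crossing block would stay in the component of [y]; idempotency
    allows it to come back only at [x], never to reach the lower [y]. *)
Lemma idempotent_linked : pb_mul (blocks s) (blocks s) == blocks s -> linked s.
Proof.
move=> /pb_mul_idemP idem.
apply/forallP=> x; apply/forallP=> y; apply/implyP=> /eqP xy.
have symH := sym_connect_sym (hook_rel_sym sK).
apply: contraT => nxy.
pose S (u : vertex3 n) := match u with
  | inl v => v = inl x
  | inr z => connect (hook_rel s) y z /\ connect e (inl (inl x)) (inr z)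
  end.
have yx : s (inr y) = inl x by rewrite -xy sK.
suff: S (inl (inr y)) by [].
have : connect e (inl (inl x)) (inl (inr y)) by rewrite idem -xy set22.
apply: (connect_ind (S := S)) => // u v Su uv.
have {}Su : S u /\ connect e (inl (inl x)) u.
  by case: u Su {uv} => [w ->|z [? ?]]; do 2?split.
case: Su => Su xu; have xv := connect_trans xu (connect1 uv).
have hookS b w z : s (port b w) = port b z -> S (inr w) ->
    connect e (inl (inl x)) (inr z) -> S (inr z).
  move=> E [yw _] xz; split=> //; apply: connect_trans yw (connect1 _).
  by apply/hook_relP; exists b.
have outS q : connect e (inl (inl x)) (inl q) -> q = inl x \/ q = inr y.
  by rewrite idem xy => /set2P.
case/edgeP: uv => p [ps [[Eu Ev]|[Eu Ev]]]; move: Su xv; rewrite {}Eu {}Ev.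
  case: p ps => w; case E: (s _) => [z|z] ps /=.
  - by case=> wx; move: E ps; rewrite wx xy.
  - by move=> -[wx]; move: E; rewrite wx xy => -[<-] xz; split.
  - by move=> _ /outS [].
  - exact: (hookS false).
case: p ps => w; case E: (s _) => [z|z] ps //=.
- exact: (hookS true).
- move=> [yw _] /outS [//|[zy]]; move: nxy; rewrite symH.
  have -> : x = w.
    by have [] : inl x = inl w :> vertex n by rewrite -yx -zy -E sK.
  by rewrite yw.
Qed.

Lemma rank_blocks : pb_rank (blocks s) = rank s.
Proof.
pose g x := [set inl x; s (inl x)].
rewrite /pb_rank /rank -(card_in_imset (f := g)).
  apply: eq_card => B; rewrite inE; apply/and3P/imsetP.
    case=> /imsetP [z _ ->] /existsP [x xB] /existsP [y yB].
    rewrite -(block_eq sK xB) in yB *; exists x => //; rewrite inE.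
    by case/set2P: yB => // <-.
  case=> x; rewrite inE => cx ->; split; first exact: imset_f.
    by apply/existsP; exists x; rewrite set21.
  case E: (s (inl x)) cx => [//|y] _.
    by apply/existsP; exists y; rewrite /g E set22.
move=> x y; rewrite !inE => cx cy E.
have : inl x \in g y by rewrite -E set21.
by case/set2P => [[]//|xE]; rewrite -xE in cy.
Qed.

End Idempotents.

Lemma e_linked n r : e (D r n) = #|linked_inv n r|.
Proof.
rewrite /e -(card_in_imset (f := @blocks (vertex n))); last first.
  by move=> s t /setIdP [sI _] /setIdP [tI _]; apply: blocks_inj.
apply: eq_card => al; apply/idP/imsetP => [|[s]].
  rewrite !inE => /andP [/andP [/andP [part le2] rk] idem].
  have [s sI sal] := blocks_surj part le2; have sK := involutionsP _ sI.
  exists s => //; apply/setIdP; rewrite sI -(rank_blocks sK) sal rk andbT.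
  by split=> //; apply: idempotent_linked => //; rewrite sal.
case/setIdP=> sI /andP [gs rk] ->; have sK := involutionsP _ sI.
rewrite !inE blocks_partition // rank_blocks // rk.
rewrite linked_idempotent // !andbT /=.
by apply/forall_inP=> _ /imsetP [z _ ->]; rewrite cards2; case: (_ == _).
Qed.

(** * Deleting a finished component *)

Section Removal.

Variables (n k : nat) (f : 'I_k -> 'I_n) (s0 : {ffun vertex n -> vertex n}).
Hypothesis injf : injective f.

Definition lift_port (z : vertex k) : vertex n := port (side z) (f (und z)).

Lemma lift_port_inj : injective lift_port.
Proof. by move=> [x|x] [y|y] // [/injf ->]. Qed.

Lemma lift_port_port b x : lift_port (port b x) = port b (f x).
Proof. by case: b. Qed.

Lemma codom_lift_port z : (z \in codom lift_port) = (und z \in codom f).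
Proof.
apply/codomP/codomP => [[p ->]|[x zx]].
  by exists (und p); rewrite und_port.
by exists (port (side z) x); rewrite lift_port_port -zx portK.
Qed.

Hypothesis s0K : involutive s0.
Hypothesis s0_fix : forall z, und z \in codom f -> s0 z = z.
Hypothesis linked0 : linked s0.

Let ext := glue lift_port s0.
Implicit Types (s : {ffun vertex k -> vertex k}).

Let ext_in s z : ext s (lift_port z) = lift_port (s z).
Proof. by rewrite /ext glue_in //; exact: lift_port_inj. Qed.

Let ext_out s z : und z \notin codom f -> ext s z = s0 z.
Proof. by move=> zf; rewrite /ext glue_out // codom_lift_port. Qed.

Let s0_out z : und z \notin codom f -> und (s0 z) \notin codom f.
Proof.
move=> zf; apply: contra (zf) => szf.
by rewrite -(s0K z) (s0_fix szf).
Qed.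

Let ext_involutive s : involutive s -> involutive (ext s).
Proof.
move=> sK z; have [|zf] := boolP (z \in codom lift_port).
  by case/codomP=> p ->; rewrite !ext_in sK.
rewrite codom_lift_port in zf.
by rewrite !ext_out ?s0_out // s0K.
Qed.

Let ext_rel s x y :
  connect (hook_rel (ext s)) (f x) (f y) = connect (hook_rel s) x y.
Proof.
apply/idP/idP => xy.
  pose S u := exists2 v, u = f v & connect (hook_rel s) x v.
  suff [v /injf ->] : S (f y) by [].
  apply: connect_ind xy; last by exists x => //; apply: connect0.
  move=> u v [w -> xw] /hook_relP [b].
  rewrite -lift_port_port ext_in => E.
  have <- : f (und (s (port b w))) = v by rewrite -(und_port b v) -E und_port.
  exists (und (s (port b w))) => //; apply: connect_trans xw (connect1 _).
  apply/hook_relP; exists b; rewrite -[LHS]portK; congr port.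
  by have := congr1 (@side n) E; rewrite !side_port.
pose S u := connect (hook_rel (ext s)) (f x) (f u).
suff: S y by [].
apply: (connect_ind (S := S) _ _ xy); last exact: connect0.
move=> u v xu /hook_relP [b E]; apply: connect_trans xu (connect1 _).
by apply/hook_relP; exists b; rewrite -!lift_port_port ext_in E.
Qed.

Let ext_linked s : involutive s -> linked (ext s) = linked s.
Proof.
move=> sK; apply/(linkedP (ext_involutive sK))/(linkedP sK) => gs p.
  move=> cr; have := gs (lift_port p).
  by rewrite ext_in !side_port !und_port ext_rel; apply.
have [|pf] := boolP (p \in codom lift_port).
  case/codomP=> z ->; rewrite ext_in !side_port !und_port ext_rel.
  exact: gs.
rewrite codom_lift_port in pf; rewrite ext_out // => cr.
apply: (@connect_hook_mono _ s0) (linkedP s0K linked0 _ cr) => z zs.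
by rewrite ext_out //; apply: contra zs => /s0_fix ->.
Qed.

Let rank_ext s : rank (ext s) = rank s0 + rank s.
Proof.
rewrite /rank addnC -(card_imset _ injf) -cardsUI.
set A := f @: _; set B := [set x | ~~ side (s0 _)].
have -> : A :&: B = set0.
  apply/setP=> x; rewrite !inE; apply/negP=> /andP [/imsetP [y _ ->]].
  by rewrite s0_fix /= ?codom_f.
rewrite cards0 addn0; apply: eq_card => x; rewrite !inE.
have [/codomP [y ->]|xf] := boolP (x \in codom f).
  rewrite (s0_fix (z := inl (f y))) /= ?codom_f //= orbF mem_imset // inE.
  by rewrite -[inl (f y)]/(lift_port (inl y)) ext_in side_port.
rewrite ext_out //; case: (x \in A) / imsetP => // -[y _ E].
by rewrite E codom_f in xf.
Qed.

(** Crossings, hooks and connectivity of a glued involution are those of its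
    two parts, as no block joins them. *)
Lemma card_linked_glue r :
  #|[set s in linked_inv n (rank s0 + r) |
       [forall (z : vertex n | und z \notin codom f), s z == s0 z]]|
    = #|linked_inv k r|.
Proof.
rewrite -(card_imset _ (@glue_inj _ _ lift_port s0 lift_port_inj)).
apply: eq_card => s.
transitivity [&& s \in glue lift_port s0 @: involutions (vertex k), linked s
                  & rank s == rank s0 + r].
  rewrite -imset_glue //; last 2 first.
  - exact: lift_port_inj.
  - by move=> z; rewrite !codom_lift_port; apply: s0_out.
  have eqF : [forall (z | z \notin codom lift_port), s z == s0 z] =
             [forall (z : vertex n | und z \notin codom f), s z == s0 z].
    by apply: eq_forallb => z; rewrite codom_lift_port.
  rewrite inE [s \in linked_inv _ _]inE [in RHS]inE eqF -!andbA.
  by congr (_ && _); rewrite [RHS]andbC -andbA.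
apply/and3P/imsetP => [[/imsetP [s1 s1I ->] gs rs] | [s1]].
  exists s1 => //; rewrite inE s1I -ext_linked ?gs //; last exact/involutionsP.
  by rewrite rank_ext eqn_add2l in rs.
rewrite inE => /and3P [s1I gs rs] ->; split; first exact: imset_f.
  by rewrite -/ext ext_linked //; exact/involutionsP.
by rewrite rank_ext eqn_add2l.
Qed.

End Removal.

(** [X] collects the ports over [C] that are left undecided. *)
Definition prescribed n (C : {set 'I_n}) (s0 : {ffun vertex n -> vertex n})
    (X : pred (vertex n)) : {set {ffun vertex n -> vertex n}} :=
  [set s : {ffun vertex n -> vertex n} |
     [forall (z : vertex n | (und z \in C) && ~~ X z), s z == s0 z]].

(** Once the blocks over [C] are all known, what remains is an involution of
    the same kind on [n - #|C|] indices. *)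
Lemma card_linked_prescribed n (C : {set 'I_n})
    (s0 : {ffun vertex n -> vertex n}) r :
  involutive s0 -> linked s0 -> (forall z, und z \notin C -> s0 z = z) ->
  #|linked_inv n (rank s0 + r) :&: prescribed C s0 pred0|
    = #|linked_inv (n - #|C|) r|.
Proof.
move=> s0K gs0 fix0.
have kE : #|~: C| = n - #|C| by have := cardsC C; rewrite card_ord; lia.
have [f injf fE] : exists2 f : 'I_(n - #|C|) -> 'I_n, injective f &
    forall x, (x \in codom f) = (x \notin C).
  case: _ / kE; exists (fun i => enum_val i); first exact: enum_val_inj.
  move=> x; apply/codomP/idP => [[i ->]|xC].
    by have := enum_valP i; rewrite inE.
  have xC' : x \in ~: C by rewrite inE.
  by exists (enum_rank_in xC' x); rewrite enum_rankK_in.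
rewrite -(card_linked_glue injf s0K _ gs0) => [|z]; last by rewrite fE => /fix0.
apply: eq_card => s; rewrite !inE; congr (_ && _).
by apply: eq_forallb => z; rewrite fE andbT negbK.
Qed.

(** * Exploring a component *)

Section Exploration.

Variables (n r : nat).
Implicit Types (C : {set 'I_n}) (s : {ffun vertex n -> vertex n})
  (p q z : vertex n).

(** A partially explored component: over the indices in [C] all hooks are known
    (they are recorded in [s0]), except that the two end ports [p] and [q] of
    the explored path are still undecided.  The partner of an undecided port is
    recorded in [s0] as the port itself. *)
Record open_path C s0 p q : Prop := OpenPath {
  op_inv : involutive s0;
  op_pq : p != q;
  op_pC : und p \in C;
  op_qC : und q \in C;
  op_p : s0 p = p;
  op_q : s0 q = q;
  op_out : forall z, und z \notin C -> s0 z = z;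
  op_side : forall z, side (s0 z) = side z;
  op_conn : connect (hook_rel s0) (und p) (und q)
}.

Lemma open_path_sym C s0 p q : open_path C s0 p q -> open_path C s0 q p.
Proof.
case=> s0K pq pC qC sp sq out sd con; split => //; first by rewrite eq_sym.
by rewrite (sym_connect_sym (hook_rel_sym s0K)).
Qed.

(** Hooking the end [p] to a new index [x] moves this end to the port of [x]
    on the other side. *)
Lemma open_path_extend C s0 p q x : open_path C s0 p q -> x \notin C ->
  open_path (x |: C) (swap_at s0 p (port (side p) x)) (port (~~ side p) x) q.
Proof.
case=> s0K pq pC qC sp sq out sd con xC.
set w := port (side p) x.
have und_w : und w = x by rewrite und_port.
have sw : s0 w = w by apply: out; rewrite und_w.
have neq z b : und z \in C -> z != port b x.
  by move=> zC; apply: contraNneq xC => E; rewrite -(und_port b x) -E.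
have s1w : swap_at s0 p w w = p by rewrite swap_atR.
split.
- exact: swap_at_involutive.
- by rewrite eq_sym neq.
- by rewrite und_port setU11.
- by rewrite setU1r.
- rewrite swap_atN; first by apply: out; rewrite und_port.
    by rewrite eq_sym neq.
  by apply/eqP=> /(congr1 (@side n)); rewrite !side_port; case: (side p).
- by rewrite swap_atN // 1?eq_sym // 1?eq_sym neq.
- move=> z; rewrite !inE negb_or => /andP [zx zC].
  rewrite swap_atN; first exact: out.
    by apply: contraNneq zC => ->.
  by apply: contraNneq zx => ->; rewrite und_w.
- move=> z; rewrite ffunE; case: eqP => [->|_]; first by rewrite side_port.
  by case: eqP => [->|_]; rewrite ?side_port.
- rewrite und_port; apply: (@connect_trans _ _ (und p)).
    apply/connect1/hook_relP; exists (side p).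
    by rewrite portK.
  apply: (connect_hook_mono _ con) => z zs; rewrite swap_atN //.
    by apply: contra zs => /eqP ->; rewrite sp.
  by apply: contra zs => /eqP ->; rewrite sw.
Qed.

Lemma prescribedP C s0 X s : reflect
  (forall z, und z \in C -> ~~ X z -> s z = s0 z) (s \in prescribed C s0 X).
Proof.
rewrite inE; apply: (iffP forallP) => sE z.
  by move=> zC zX; apply/eqP/(implyP (sE z)); rewrite zC.
by apply/implyP=> /andP [zC zX]; apply/eqP/sE.
Qed.

Lemma prescribed_extend C s0 p q x s : open_path C s0 p q -> x \notin C ->
  involutive s ->
  (s \in prescribed (x |: C) (swap_at s0 p (port (side p) x))
           (pred2 (port (~~ side p) x) q))
  = (s \in prescribed C s0 (pred2 p q)) && (s p == port (side p) x).
Proof.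
case=> s0K pq pC qC sp sq out sd con xC sK.
set w := port (side p) x.
have neq z b : und z \in C -> z != port b x.
  by move=> zC; apply: contraNneq xC => E; rewrite -(und_port b x) -E.
apply/prescribedP/andP => [sE|[/prescribedP sE /eqP spw] z].
  split; last first.
    rewrite (sE p) ?swap_atL ?eqxx ?setU1r //=.
    by rewrite negb_or pq neq.
  apply/prescribedP=> z zC /norP [zp zq].
  rewrite (sE z) ?setU1r ?swap_atN ?neq //=.
  by rewrite negb_or zq neq.
rewrite !inE => /orP [/eqP zx|zC] /norP [/= zp' zq].
  have -> : z = w.
    have [//|zw] : z = w \/ z = flip w by apply: und_eq; rewrite und_port.
    by move: zp'; rewrite zw /w /flip side_port und_port eqxx.
  by rewrite swap_atR -spw sK.
have [->|zp] := eqVneq z p; first by rewrite swap_atL.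
by rewrite swap_atN ?neq // sE //= negb_or zp zq.
Qed.

Lemma prescribed_close C s0 p q s : s0 p = p -> s0 q = q ->
  und p \in C -> und q \in C ->
  (s \in prescribed C s0 pred0)
  = (s \in prescribed C s0 (pred2 p q)) && ((s p == p) && (s q == q)).
Proof.
move=> sp sq pC qC; apply/prescribedP/andP => [sE|].
  split; first by apply/prescribedP=> z zC _; apply: sE.
  by rewrite !sE // sp sq !eqxx.
case=> /prescribedP sE /andP [/eqP spp /eqP sqq] z zC _.
have [->|zp] := eqVneq z p; first by rewrite spp sp.
have [->|zq] := eqVneq z q; first by rewrite sqq sq.
by rewrite sE //= negb_or zp zq.
Qed.

Lemma prescribed_join C s0 p q s : involutive s ->
  und p \in C -> und q \in C ->
  (s \in prescribed C (swap_at s0 p q) pred0)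
  = (s \in prescribed C s0 (pred2 p q)) && (s p == q).
Proof.
move=> sK pC qC; apply/prescribedP/andP => [sE|].
  split; last by rewrite sE // swap_atL.
  by apply/prescribedP=> z zC /norP [zp zq]; rewrite sE // swap_atN.
case=> /prescribedP sE /eqP spq z zC _.
have [->|zp] := eqVneq z p; first by rewrite spq swap_atL.
have [->|zq] := eqVneq z q; first by rewrite -spq sK spq swap_atR.
by rewrite swap_atN // sE //= negb_or zp zq.
Qed.

Lemma no_crossing s : (forall z, side (s z) = side z) ->
  linked s /\ rank s = 0.
Proof.
move=> sd; split.
  apply/forallP=> x; apply/forallP=> y; apply/implyP=> /eqP E.
  by have := sd (inl x); rewrite E.
by apply/eqP; rewrite cards_eq0; apply/eqP/setP=> x; rewrite !inE sd.
Qed.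

(** The three ways to finish a component: both ends single, the ends joined by
    a hook into a cycle, or joined by a crossing block. *)
Lemma card_close C s0 p q : open_path C s0 p q ->
  #|linked_inv n r.+1 :&: prescribed C s0 pred0|
    = #|linked_inv (n - #|C|) r.+1|.
Proof.
case=> s0K _ _ _ _ _ out /no_crossing [gs0 rk0] _.
by rewrite -(card_linked_prescribed r.+1 s0K gs0 out) rk0.
Qed.

Lemma swap_at_out C s0 p q : open_path C s0 p q ->
  forall z, und z \notin C -> swap_at s0 p q z = z.
Proof.
case=> _ _ pC qC _ _ out _ _ z zC; rewrite swap_atN ?out //.
  by apply: contraNneq zC => ->.
by apply: contraNneq zC => ->.
Qed.

Lemma card_cycle C s0 p q : open_path C s0 p q -> side p = side q ->
  #|linked_inv n r.+1 :&: prescribed C (swap_at s0 p q) pred0|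
    = #|linked_inv (n - #|C|) r.+1|.
Proof.
move=> op pq; have [s0K _ _ _ sp sq _ sd _] := op.
have [gs0 rk0] : linked (swap_at s0 p q) /\ rank (swap_at s0 p q) = 0.
  by apply: no_crossing => z; rewrite ffunE; do 2?case: eqP => [->|_] //.
have sK := swap_at_involutive s0K sp sq.
by rewrite -(card_linked_prescribed r.+1 sK gs0 (swap_at_out op)) rk0.
Qed.

Lemma card_cross C s0 p q : open_path C s0 p q -> side p != side q ->
  #|linked_inv n r.+1 :&: prescribed C (swap_at s0 p q) pred0|
    = #|linked_inv (n - #|C|) r|.
Proof.
move=> op pq; have [s0K npq _ _ sp sq _ sd con] := op.
have sK := swap_at_involutive s0K sp sq.
have mono : subrel (connect (hook_rel s0))
                   (connect (hook_rel (swap_at s0 p q))).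
  apply: connect_hook_mono => z zs; rewrite swap_atN //.
    by apply: contra zs => /eqP ->; rewrite sp.
  by apply: contra zs => /eqP ->; rewrite sq.
have gs : linked (swap_at s0 p q).
  apply/(linkedP sK) => z; have [->|zp] := eqVneq z p.
    by rewrite swap_atL => _; apply: mono.
  have [->|zq] := eqVneq z q.
    by rewrite swap_atR (sym_connect_sym (hook_rel_sym sK)) => _; apply: mono.
  by rewrite swap_atN // sd eqxx.
have rk : rank (swap_at s0 p q) = 1.
  apply/eqP/cards1P; exists (if side p then und p else und q).
  apply/setP=> x; rewrite !inE ffunE.
  have inlE z : (inl x == z) = side z && (x == und z) by case: z.
  rewrite !inlE; case Ep: (side p) pq; case Eq: (side q) => //= _.
    by case: (_ == _); rewrite ?Eq // sd.
  by case: (_ == _); rewrite ?Ep // sd.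
by rewrite -(card_linked_prescribed r sK gs (swap_at_out op)) rk add1n.
Qed.

(** If [p] crosses, its partner is an unhooked port of the same component, so it
    can only be the other end [q] by the bound of two unhooked ports. *)
Lemma both_unhooked C s0 p q s : open_path C s0 p q ->
  s \in linked_inv n r.+1 -> s \in prescribed C s0 (pred2 p q) ->
  unhooked s p -> unhooked s q ->
  (s p == p) && (s q == q) || (side p != side q) && (s p == q).
Proof.
case=> s0K npq pC qC sp sq out sd con /setIdP [/involutionsP sK /andP [gs _]].
move=> /prescribedP sE up uq.
have pq : connect (hook_rel s) (und p) (und q).
  apply: (connect_hook_mono _ con) => z zs; apply: sE.
    by apply: contraR zs => /out ->.
  by apply: contra zs => /orP [] /eqP ->; rewrite ?sp ?sq.
have cross u v : unhooked s u -> s u != u -> unhooked s v -> u != v ->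
    connect (hook_rel s) (und u) (und v) -> s u = v /\ side u != side v.
  move=> uu su uv neq uvc.
  have cu : side (s u) != side u by move: uu; rewrite /unhooked (negPf su).
  have us := linkedP sK gs _ cu.
  have E : s u = v.
    by apply: (two_unhooked sK uu _ uv us uvc su);
      rewrite 1?eq_sym // unhooked_partner.
  by rewrite -E eq_sym.
have [spp|spp] := eqVneq (s p) p; last first.
  by have [-> ->] := cross _ _ up spp uq npq pq; rewrite eqxx orbT.
have [//|sqq] := eqVneq (s q) q.
have qp : connect (hook_rel s) (und q) (und p).
  by rewrite (sym_connect_sym (hook_rel_sym sK)).
rewrite eq_sym in npq.
have [E _] := cross _ _ uq sqq up npq qp.
by rewrite -E sK E eqxx in spp *; rewrite spp eqxx in npq.
Qed.

Lemma hookedE C s0 p q s : open_path C s0 p q -> involutive s ->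
  s \in prescribed C s0 (pred2 p q) -> ~~ unhooked s p ->
  s p = q \/ (und (s p) \notin C /\ s p = port (side p) (und (s p))).
Proof.
case=> s0K npq pC qC sp sq out sd con sK /prescribedP sE.
rewrite /unhooked negb_or negbK => /andP [spp /eqP side_sp].
have [->|spq] := eqVneq (s p) q; [by left|right].
split; last by rewrite -side_sp portK.
apply: contraNN spp => spC; have := sE _ spC.
rewrite /= negb_or spq andbT sK; case: (eqVneq (s p) p) => // sp' /(_ isT) E.
by rewrite -(s0K (s p)) -E sp eqxx in sp'.
Qed.

(** [K] is a further condition on the undecided ports: none, or that [q] is
    already known to be unhooked. *)
Definition extensions (K : pred {ffun vertex n -> vertex n}) C s0 p q :=
  [set s in linked_inv n r.+1 :&: prescribed C s0 (pred2 p q) | K s].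

(** A hook at [p] closes the path into a cycle, or prolongs it to an unexplored
    index. *)
Lemma card_hooked K C s0 p q : open_path C s0 p q ->
  #|[set s in extensions K C s0 p q | ~~ unhooked s p]|
    = (if side p == side q
       then #|[set s in extensions K C s0 p q | s p == q]| else 0)
      + \sum_(x in ~: C)
          #|extensions K (x |: C) (swap_at s0 p (port (side p) x))
              (port (~~ side p) x) q|.
Proof.
move=> op; have [s0K npq pC qC sp sq out sd con] := op.
rewrite -(cardsID [set s : {ffun vertex n -> vertex n} | s p == q]).
congr (_ + _).
  case: eqVneq => pq; last first.
    apply/eqP; rewrite cards_eq0; apply/eqP/setP=> s; rewrite !inE.
    case: (eqVneq (s p) q) => [E|]; rewrite ?andbF //.
    by rewrite /unhooked E (eq_sym (side q)) pq orbT andbF.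
  apply: eq_card => s; apply/setIP/setIdP => [[/setIdP [sX _]]|[sX /eqP E]].
    by rewrite inE.
  rewrite inE E eqxx; split=> //; apply/setIdP; split=> //.
  by rewrite /unhooked E eq_sym (negPf npq) pq eqxx.
rewrite (@card_fibres _ _ _ (~: C)
  (fun s : {ffun vertex n -> vertex n} => und (s p))); last first.
  move=> s; rewrite in_setD => /andP [].
  rewrite [_ \in [set s | _]]inE => spq /setIdP [/setIdP [/setIP [sG sE] _] hk].
  have /setIdP [/involutionsP sK _] := sG.
  rewrite inE; case: (hookedE op sK sE hk) => [E|[]//].
  by rewrite E eqxx in spq.
apply: eq_bigr => x; rewrite inE => xC; apply: eq_card => s.
apply/setIdP/setIdP.
  case; rewrite in_setD => /andP [].
  rewrite [_ \in [set s | _]]inE => spq.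
  case/setIdP=> /setIdP [/setIP [sG sE] Ks] hk /eqP xE.
  have /setIdP [/involutionsP sK _] := sG.
  case: (hookedE op sK sE hk) => [E|[_ E]]; first by rewrite E eqxx in spq.
  split=> //; apply/setIP; split=> //; rewrite prescribed_extend // sE E xE.
  by rewrite eqxx.
case=> /setIP [sG]; have /setIdP [/involutionsP sK _] := sG.
rewrite prescribed_extend // => /andP [sE /eqP spx] Ks.
rewrite spx und_port eqxx; split=> //; rewrite in_setD; apply/andP; split.
  rewrite inE spx; apply: contraNneq xC => E.
  by rewrite -(und_port (side p) x) E.
apply/setIdP; split; first by apply/setIdP; split=> //; apply/setIP.
rewrite /unhooked spx side_port eqxx orbF; apply: contraNneq xC => E.
by rewrite -(und_port (side p) x) E.
Qed.

End Exploration.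

(** * The recurrence *)

Section Recursion.

Variables F1 F0 : nat -> nat.

(** Numbers of ways to complete a partially explored component when [m] indices
    are unexplored: [F1] and [F0] count the involutions on the rest that
    have the wanted rank, respectively one less, and [b] says whether the two
    ends of the explored path lie on different sides, so that a crossing block
    may join them.  In [one_open] the other end is already known to be
    unhooked. *)
Fixpoint one_open m (b : bool) :=
  F1 m + b * F0 m + (if m is m'.+1 then m * one_open m' (~~ b) else 0).

Fixpoint both_open m (b : bool) :=
  one_open m b + ~~ b * F1 m
    + (if m is m'.+1 then m * both_open m' (~~ b) else 0).

(** The falling factorial counts the ordered choices of [l] new indices; each
    new index changes the side of the end that it prolongs. *)
Lemma one_openE m b : one_open m b =
  \sum_(l < m.+1) m ^_ l * (F1 (m - l) + (b (+) odd l) * F0 (m - l)).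
Proof.
elim: m b => [|m IHm] b.
  by rewrite big_ord1 /= addbF mul1n !addn0.
rewrite big_ord_recl /= ffactn0 mul1n addbF subn0; congr (_ + _).
rewrite IHm big_distrr; apply: eq_bigr => l _.
by rewrite /bump /= add1n ffactnS subSS mulnA /= addbN addNb.
Qed.

(** The factor [l.+1] is the number of ways to distribute [l] new indices
    between the two ends. *)
Lemma both_openE m b : both_open m b =
  \sum_(l < m.+1) m ^_ l * (l.+1 * (F1 (m - l) + (b (+) odd l) * F0 (m - l))
                            + ~~ (b (+) odd l) * F1 (m - l)).
Proof.
elim: m b => [|m IHm] b.
  by rewrite big_ord1 /= addbF !mul1n !addn0.
have -> : both_open m.+1 b
    = one_open m.+1 b + ~~ b * F1 m.+1 + m.+1 * both_open m (~~ b) by [].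
rewrite one_openE big_ord_recl [RHS]big_ord_recl -addnA addnACA.
congr (_ + _); first by rewrite /= !ffactn0 addbF subn0 !mul1n.
rewrite IHm big_distrr -big_split; apply: eq_bigr => l _.
rewrite /= [bump 0 l]add1n ffactnS subSS /= addbN addNb.
by set u := F1 _; set v := F0 _; set c := m ^_ l; case: (_ (+) _) => /=; ring.
Qed.

End Recursion.

Section Counting.

Variables (n r : nat).

Let F1 m := #|linked_inv m r.+1|.
Let F0 m := #|linked_inv m r|.

Lemma card_both_unhooked C (s0 : {ffun vertex n -> vertex n}) p q :
  open_path C s0 p q ->
  #|[set s in extensions r (fun s => unhooked s q) C s0 p q | unhooked s p]|
    = F1 (n - #|C|) + (side p != side q) * F0 (n - #|C|).
Proof.
move=> op; have [s0K npq pC qC sp sq out sd con] := op.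
rewrite -(cardsID (prescribed C s0 pred0)); congr (_ + _).
  rewrite /F1 -(card_close r op); apply: eq_card => s; apply/setIP/setIP.
    by case=> /setIdP [/setIdP [/setIP [sG sE] uq] up] sE0.
  case=> sG; rewrite (prescribed_close s sp sq pC qC) => sE; split=> //.
  case/and3P: sE => sE /eqP spp /eqP sqq.
  apply/setIdP; rewrite /unhooked spp eqxx; split=> //.
  by apply/setIdP; rewrite sqq eqxx; split=> //; apply/setIP.
case: eqVneq => [pq|pq]; rewrite ?mul1n ?mul0n.
  apply/eqP; rewrite cards_eq0; apply/eqP/setP=> s; rewrite [RHS]inE.
  apply/setDP=> -[/setIdP [/setIdP [/setIP [sG sE] uq] up]].
  have := both_unhooked op sG sE up uq; rewrite pq eqxx orbF => E.
  by rewrite (prescribed_close s sp sq pC qC) sE E.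
rewrite /F0 -(card_cross r op pq); apply: eq_card => s; apply/setDP/setIP.
  case=> /setIdP [/setIdP [/setIP [sG sE] uq] up].
  rewrite (prescribed_close s sp sq pC qC) sE /= => /negPf nE.
  have /setIdP [/involutionsP sK _] := sG.
  have := both_unhooked op sG sE up uq; rewrite nE pq /= => spq.
  by rewrite prescribed_join // sE spq.
case=> sG; have /setIdP [/involutionsP sK _] := sG.
rewrite prescribed_join // => /andP [sE /eqP spq].
have sqp : s q = p by rewrite -spq sK.
rewrite (prescribed_close s sp sq pC qC) spq [q == p]eq_sym (negPf npq) andbF.
split=> //; apply/setIdP.
rewrite /unhooked spq (eq_sym (side q)) pq orbT; split=> //.
apply/setIdP; rewrite sqp pq orbT; split=> //; exact/setIP.
Qed.

Lemma card_sum_extend (C : {set 'I_n}) (G : 'I_n -> nat) c :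
  (forall x, x \notin C -> G x = c (n - #|x |: C|)) ->
  \sum_(x in ~: C) G x
    = if n - #|C| is m.+1 then m.+1 * c m else 0.
Proof.
move=> GE; rewrite (eq_bigr (fun=> c (n - #|C|).-1)) => [|x]; last first.
  by rewrite inE => xC; rewrite GE // cardsU1 xC add1n subnS.
rewrite sum_nat_const; have -> : #|~: C| = n - #|C|.
  by have := cardsC C; rewrite card_ord; lia.
by case: (n - #|C|).
Qed.

Lemma card_split (T : finType) (A : {set T}) (K : pred T) :
  #|A| = #|[set s in A | K s]| + #|[set s in A | ~~ K s]|.
Proof.
rewrite -(cardsID [set s | K s] A).
by congr (_ + _); apply: eq_card => s; rewrite !inE // andbC.
Qed.

Lemma card_one_open C (s0 : {ffun vertex n -> vertex n}) p q :
  open_path C s0 p q ->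
  #|extensions r (fun s => unhooked s q) C s0 p q|
    = one_open F1 F0 (n - #|C|) (side p != side q).
Proof.
move: {2}(n - #|C|) (leqnn (n - #|C|)) => m.
elim/ltn_ind: m C s0 p q => m IHm C s0 p q le_m op.
rewrite (card_split _ (fun s => unhooked s p)) card_both_unhooked //.
rewrite card_hooked //.
(* A cycle would hook [q]. *)
have -> : (if side p == side q
    then #|[set s in extensions r (fun s => unhooked s q) C s0 p q | s p == q]|
    else 0) = 0.
  case: eqVneq => // pq; apply/eqP; rewrite cards_eq0; apply/eqP/setP=> s.
  rewrite [RHS]inE; apply/setIdP=> -[/setIdP [/setIP [sG _] uq] /eqP spq].
  have /setIdP [/involutionsP sK _] := sG.
  have npq := op_pq op; move: uq.
  by rewrite /unhooked -spq sK spq pq eqxx (negPf npq).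
rewrite add0n.
rewrite (card_sum_extend
  (c := fun k => one_open F1 F0 k (~~ (side p != side q)))).
  by case: (n - #|C|).
move=> x xC; have lt_C := max_card (x |: C).
rewrite card_ord cardsU1 xC in lt_C.
rewrite (IHm (n - #|x |: C|)) //.
- by rewrite side_port; congr one_open; case: (side p) (side q) => [] [].
- by rewrite cardsU1 xC; lia.
- exact: open_path_extend.
Qed.

Lemma card_both_open C (s0 : {ffun vertex n -> vertex n}) p q :
  open_path C s0 p q ->
  #|extensions r predT C s0 p q|
    = both_open F1 F0 (n - #|C|) (side p != side q).
Proof.
move: {2}(n - #|C|) (leqnn (n - #|C|)) => m.
elim/ltn_ind: m C s0 p q => m IHm C s0 p q le_m op.
rewrite (card_split _ (fun s => unhooked s p)) card_hooked //.
have -> : #|[set s in extensions r predT C s0 p q | unhooked s p]|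
    = one_open F1 F0 (n - #|C|) (side p != side q).
  (* From here on [p] plays the part of the finished end. *)
  rewrite eq_sym -(card_one_open (open_path_sym op)); apply: eq_card => s.
  rewrite !inE !andbT; do 2!congr (_ && _); apply: eq_forallb => z.
  by rewrite /= orbC.
have -> : (if side p == side q
    then #|[set s in extensions r predT C s0 p q | s p == q]| else 0)
    = ~~ (side p != side q) * F1 (n - #|C|).
  case: eqVneq => pq //=; rewrite mul1n /F1 -(card_cycle r op pq).
  have [pC qC] := (op_pC op, op_qC op).
  apply: eq_card => s.
  apply/setIdP/setIP => [[/setIdP [/setIP [sG sE] _] spq]|[sG]];
    have /setIdP [/involutionsP sK _] := sG; rewrite prescribed_join //.
    by rewrite sE.
  case/andP=> sE spq; split=> //; apply/setIdP; split=> //; exact/setIP.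
rewrite addnA (card_sum_extend
  (c := fun k => both_open F1 F0 k (~~ (side p != side q)))).
  by case: (n - #|C|).
move=> x xC; have lt_C := max_card (x |: C).
rewrite card_ord cardsU1 xC in lt_C.
rewrite (IHm (n - #|x |: C|)) //.
- by rewrite side_port; congr both_open; case: (side p) (side q) => [] [].
- by rewrite cardsU1 xC; lia.
- exact: open_path_extend.
Qed.

End Counting.

(** Explore the component of the index [0], starting from the path that consists
    of this index alone and whose two ends are its two ports. *)
Lemma card_linked_rec n r : #|linked_inv n.+1 r.+1| =
  \sum_(l < n.+1) n ^_ l *
     (l.+1 * (#|linked_inv (n - l) r.+1| + ~~ odd l * #|linked_inv (n - l) r|)
      + odd l * #|linked_inv (n - l) r.+1|).
Proof.
pose v : 'I_n.+1 := ord0; pose s0 := [ffun z : vertex n.+1 => z].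
have op : open_path [set v] s0 (inl v) (inr v).
  by split; rewrite ?ffunE ?inE // => z *; rewrite !ffunE.
have := card_both_open r op.
rewrite cards1 subn1 both_openE /=.
under eq_bigr => l _ do rewrite -/(~~ odd l) negbK.
move=> <-; apply: eq_card => s; rewrite [RHS]inE andbT in_setI.
suff -> : s \in prescribed [set v] s0 (pred2 (inl v) (inr v)) by rewrite andbT.
apply/prescribedP=> z; rewrite inE => /eqP zv /=.
by case: z zv => x /= ->; rewrite eqxx ?orbT.
Qed.

Lemma sum_parity n (G : nat -> nat) :
  \sum_(0 <= l < n) G l
    = \sum_(0 <= i < n./2) G (2 * i + 1) + \sum_(0 <= i < uphalf n) G (2 * i).
Proof.
elim: n => [|n IHn]; first by rewrite !big_geq.
rewrite big_nat_recr //= IHn uphalf_half.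
have := odd_double_half n; case: (odd n) => /= nE; rewrite ?add1n ?add0n.
  rewrite [in RHS]big_nat_recr //= -addnA [_ + G n]addnC addnA.
  by congr (_ + G _ + _); lia.
by rewrite -addnA [in RHS]big_nat_recr //=; congr (_ + (_ + G _)); lia.
Qed.

(** With all blocks crossing there are no hooks, and each block has to join the
    two copies of one index. *)
Lemma card_linked_full n : #|linked_inv n n| = 1.
Proof.
apply/eqP/cards1P; exists [ffun z => flip z].
apply/setP=> s; rewrite [RHS]inE; apply/setIdP/eqP.
  case=> /involutionsP sK /andP [gs /eqP rk].
  have cr x : s (inl x) = inr (und (s (inl x))).
    have : x \in [set x | ~~ side (s (inl x))].
      suff -> : [set x | ~~ side (s (inl x))] = setT by rewrite inE.
      apply/eqP; rewrite eqEcard subsetT cardsT card_ord.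
      by rewrite -[X in X <= _]rk leqnn.
    by rewrite inE; case: (s _).
  have injg : injective (fun x => und (s (inl x))).
    move=> x y E; have : s (inl x) = s (inl y) by rewrite cr E -cr.
    by move/(inv_inj sK) => -[].
  have crR y : side (s (inr y)).
    have [g _ gK] := injF_bij injg.
    by rewrite -[y]gK -cr sK.
  have sE x : s (inl x) = inr x.
    rewrite cr; congr inr.
    have /implyP := forallP (forallP gs x) (und (s (inl x))).
    rewrite -cr eqxx => /(_ isT) xy; symmetry.
    apply: (connect_ind (S := fun u => x = u) _ _ xy) => // u w _.
    case/hook_relP=> -[] Eb; first by rewrite cr in Eb.
    by have := crR u; rewrite Eb.
  apply/ffunP=> -[x|x]; rewrite ffunE /flip /=; first exact: sE.
  by rewrite -[in LHS]sE sK.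
move=> ->; split; first by apply/involutionsP=> z; rewrite !ffunE flipK.
apply/andP; split.
  apply/forallP=> x; apply/forallP=> y; apply/implyP; rewrite ffunE.
  by case/eqP=> ->; apply: connect0.
rewrite /rank (_ : [set x | _] = setT) ?cardsT ?card_ord //.
by apply/setP=> x; rewrite !inE ffunE.
Qed.

(** Without crossings the condition on hooks is void, and the upper and the
    lower halves are arbitrary involutions. *)
Lemma card_linked_0 n : #|linked_inv n 0| = a n ^ 2.
Proof.
pose I := involutions 'I_n.
have cI : #|I| = a n by rewrite card_involutions card_ord.
pose g (UL : {ffun 'I_n -> 'I_n} * {ffun 'I_n -> 'I_n}) :
    {ffun vertex n -> vertex n} := [ffun z =>
  match z with inl x => inl (UL.1 x) | inr x => inr (UL.2 x) end].
rewrite expnS expn1 -cI -cardsX -(card_imset _ (f := g)); last first.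
  move=> [U L] [U' L'] /ffunP E; congr pair; apply/ffunP=> x.
    by have := E (inl x); rewrite !ffunE => -[].
  by have := E (inr x); rewrite !ffunE => -[].
apply: eq_card => s; apply/setIdP/imsetP => [[]|[[U L]]]; last first.
  case/setXP=> /involutionsP UK /involutionsP LK ->; split.
    by apply/involutionsP=> -[x|x]; rewrite !ffunE /= ?UK ?LK.
  have [-> ->] : linked (g (U, L)) /\ rank (g (U, L)) = 0 by
    apply: no_crossing => -[x|x]; rewrite ffunE.
  by [].
move=> /involutionsP sK /andP [_ /eqP rk].
have sdL x : side (s (inl x)).
  apply: contraT => cx.
  have : x \in [set x | ~~ side (s (inl x))] by rewrite inE.
  by rewrite (cards0_eq rk) inE.
have sdR y : ~~ side (s (inr y)).
  case E: (s (inr y)) => [x|//]; have := sdL x.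
  by rewrite -E sK.
have sL x : s (inl x) = inl (und (s (inl x))) by case: (s _) (sdL x).
have sR x : s (inr x) = inr (und (s (inr x))) by case: (s _) (sdR x).
exists ([ffun x => und (s (inl x))], [ffun x => und (s (inr x))]).
  apply/setXP; split; apply/involutionsP=> x; rewrite !ffunE.
    by rewrite -sL sK.
  by rewrite -sR sK.
by apply/ffunP=> -[x|x]; rewrite !ffunE.
Qed.

Theorem theorem25 (n : nat) :
  [/\ e (D n n) = 1,
      e (D 0 n) = a n ^ 2
    & forall r : nat, 1 <= n -> 1 <= r <= n - 1 ->
      e (D r n) =
        \sum_(1 <= i < (n %/ 2).+1)
           'C(n - 1, 2 * i - 1) * (2 * i + 1) * (2 * i - 1)`! * e (D r (n - 2 * i))
      + \sum_(0 <= i < ((n - 1) %/ 2).+1)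
           'C(n - 1, 2 * i) * (2 * i + 1)`!
             * (e (D r (n - 2 * i - 1)) + e (D (r - 1) (n - 2 * i - 1)))].
Proof.
split=> [||r].
- by rewrite e_linked card_linked_full.
- by rewrite e_linked card_linked_0.
case: n r => [//|n] [//|r] _ _; rewrite !subn1 /=.
rewrite e_linked card_linked_rec -(big_mkord xpredT
  (fun l => n ^_ l *
     (l.+1 * (#|linked_inv (n - l) r.+1| + ~~ odd l * #|linked_inv (n - l) r|)
      + odd l * #|linked_inv (n - l) r.+1|))) sum_parity.
(* A component of even size [2 * i] has [l = 2 * i - 1] further indices, one
   of odd size has [l = 2 * i]. *)
rewrite !divn2; congr (_ + _).
  rewrite big_add1 /=; apply: eq_bigr => i _.
  rewrite e_linked mulnS.
  have -> : 2 + 2 * i - 1 = 2 * i + 1 by lia.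
  have -> : n.+1 - (2 + 2 * i) = n - (2 * i + 1) by lia.
  rewrite oddD mul2n odd_double /= mul0n addn0 mul1n -bin_ffact.
  rewrite (_ : 2 + i.*2 + 1 = (i.*2 + 1).+2); last by lia.
  by set k := i.*2 + 1; set u := #|_|; ring.
apply: eq_bigr => i _; rewrite !e_linked.
have -> : n.+1 - 2 * i - 1 = n - 2 * i by lia.
rewrite mul2n odd_double mul1n mul0n addn0 addn1 factS -bin_ffact.
by set u := #|_|; set v := #|_|; ring.
Qed.
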